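(* Let $n\ge 3$. The image of $\mathcal{O}_\Sigma$ in $\mathcal{O}_{\bar\Delta}$ equals $\mathcal{S}$, where $\Sigma=\Sigma_{2n-3,n-1}$ is the geometric open swallowtail associated to $\Delta_n$ and $\mathcal{S}$ is the algebraic open swallowtail.
   Context: $\mathbb{K}$ is an algebraically closed field of characteristic zero. Everything is affine, and for an affine variety $X$, $\mathcal{O}_X$ denotes its coordinate ring. Write $x^{(k)}:=x^k/k!$. For $m\ge k\ge 2$, identify $\mathbb{A}^m$ (coordinates $s_1,\dots,s_m$) with the space of polynomials $x^{(m)}+s_1x^{(m-1)}+\cdots+s_m$, and let $\Sigma_{m,k}\subset\mathbb{A}^m$ be the reduced closed subvariety of polynomials having a root of multiplicity at least $k$. For $k>2$, differentiation gives a finite birational map $\Sigma_{m,k}\to\Sigma_{m-1,k-1}$, $(s_1,\dots,s_m)\mapsto(s_1,\dots,s_{m-1})$. Put $\Delta=\Delta_n:=\Sigma_{n,2}$ (the affine discriminant). The geometric open swallowtail is $\Sigma:=\Sigma_{2n-3,n-1}$, mapping to $\Delta_n$ by $(n-3)$-fold differentiation. $\bar\Delta:=\{(f,t): f(t)=f'(t)=0\}$, with $f$ ranging over the polynomials $x^{(n)}+s_1x^{(n-1)}+\cdots+s_n$ and $t\in\mathbb{A}^1$; the projection $\bar\Delta\to\Delta$ is the normalization. Since the maps between the $\Sigma_{m,k}$ are finite and birational, $\bar\Delta$ is also the normalization of $\Sigma$: the map $\bar\Delta\to\Sigma$ sends $(f,t)$ to the unique polynomial with $(n-3)$-rd derivative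 $f$ having $t$ as a root of multiplicity at least $n-1$. Thus $\mathcal{O}_\Delta\subset\mathcal{O}_\Sigma\hookrightarrow\mathcal{O}_{\bar\Delta}$. The algebraic open swallowtail $\mathcal{S}$ is the kernel of the universal derivation $d:\mathcal{O}_{\bar\Delta}\to\Omega^1_{\bar\Delta/\Delta}$, an $\mathcal{O}_\Delta$-subalgebra of $\mathcal{O}_{\bar\Delta}$. *)

(* Defs.v *)
(* Classical logic (boolp) only serves to make ideals and submodules boolean
   predicates, as the library's quotients require. *)
From HB Require Import structures.
From mathcomp Require Import all_boot all_order all_algebra.
From mathcomp Require Import generic_quotient ring_quotient.
From mathcomp Require Import boolp finmap.
From mathcomp Require Import monalg mpoly.

Set Implicit Arguments.
Unset Strict Implicit.
Unset Printing Implicit Defensive.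

Import GRing.Theory.
Local Open Scope ring_scope.
Local Open Scope quotient_scope.

Section FreeModule.
Variables (I : choiceType) (B : comPzRingType).

(* The library makes {malg B[I]} a module only for nontrivial B. *)
Definition free_module := {malg B[I]}.

HB.instance Definition _ := GRing.Zmodule.on free_module.

Implicit Types u v : free_module.

Definition free_gen (i : I) : free_module := mkmalgU i 1.

Definition free_scale (b : B) u : free_module :=
  \sum_(i <- monalg.msupp u) mkmalgU i (b * monalg.mcoeff i u).

Lemma free_scaleE b u i : monalg.mcoeff i (free_scale b u) = b * monalg.mcoeff i u.
Proof.
rewrite {2}[u]monalg.monalgE !raddf_sum mulr_sumr /=.
by apply/eq_bigr => j _; rewrite !monalg.mcoeffU mulrnAr.
Qed.

Lemma free_scaleA b c u : free_scale b (free_scale c u) = free_scale (b * c) u.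
Proof. by apply/monalg.malgP=> i; rewrite !free_scaleE mulrA. Qed.

Lemma free_scale1 u : free_scale 1 u = u.
Proof. by apply/monalg.malgP=> i; rewrite !free_scaleE mul1r. Qed.

Lemma free_scaleDr b : {morph free_scale b : u v / u + v}.
Proof.
move=> u v; apply/monalg.malgP=> i.
by rewrite !(monalg.mcoeffD, free_scaleE) mulrDr.
Qed.

Lemma free_scaleDl u : {morph free_scale^~ u : b c / b + c}.
Proof.
move=> b c; apply/monalg.malgP=> i.
by rewrite !(monalg.mcoeffD, free_scaleE) mulrDl.
Qed.

HB.instance Definition _ := GRing.Zmodule_isLmodule.Build B free_module
  free_scaleA free_scale1 free_scaleDr (fun u b c => free_scaleDl u b c).

Lemma free_sum u : u = \sum_(i <- monalg.msupp u) monalg.mcoeff i u *: free_gen i.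
Proof.
rewrite {1}[u]monalg.monalgE; apply: eq_bigr => i _; apply/monalg.malgP => j.
by rewrite [RHS]free_scaleE !monalg.mcoeffU mulrnAr mulr1.
Qed.

Section Lift.
Variables (M : lmodType B) (h : I -> M).

Definition free_lift u : M := \sum_(i <- monalg.msupp u) monalg.mcoeff i u *: h i.

Lemma free_liftE (s : {fset I}) u :
  (monalg.msupp u `<=` s)%fset -> free_lift u = \sum_(i <- s) monalg.mcoeff i u *: h i.
Proof.
move=> us; rewrite /free_lift (big_fset_incl _ us) // => i _ hi.
by rewrite monalg.mcoeff_outdom ?scale0r.
Qed.

Lemma free_lift_linear : linear free_lift.
Proof.
move=> b u v; set s := (monalg.msupp u `|` monalg.msupp v `|` monalg.msupp (b *: u + v))%fset.
rewrite (@free_liftE s) ?(@free_liftE s u) ?(@free_liftE s v); last first.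
- by apply/fsubsetP => i hi; rewrite !inE hi ?orbT.
- by apply/fsubsetP => i hi; rewrite !inE hi ?orbT.
- by apply/fsubsetP => i hi; rewrite !inE hi ?orbT.
rewrite scaler_sumr -big_split /=; apply: eq_bigr => i _.
by rewrite monalg.mcoeffD free_scaleE scalerDl scalerA.
Qed.

HB.instance Definition _ :=
  GRing.isLinear.Build B free_module M _ free_lift free_lift_linear.

Lemma free_lift_gen i : free_lift (free_gen i) = h i.
Proof.
rewrite (@free_liftE [fset i]%fset) ?big_seq_fset1 ?monalg.mcoeffU ?eqxx ?scale1r //.
exact: monalg.msuppU_le.
Qed.
End Lift.
End FreeModule.

Section Kaehler.
Variables (A B : comPzRingType) (phi : {rmorphism A -> B}).

Definition derivation (M : lmodType B) (D : B -> M) :=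
  [/\ forall x y, D (x + y) = D x + D y,
      forall x y, D (x * y) = x *: D y + y *: D x
    & forall a, D (phi a) = 0].

Local Notation F := (free_module B B).
Local Notation "'[d' x ]" := (free_gen B x : F).

Variant kaehler_rel : F -> Prop :=
| KaehlerAdd x y : kaehler_rel ([d (x + y)] - ([d x] + [d y]))
| KaehlerMul x y : kaehler_rel ([d (x * y)] - (x *: [d y] + y *: [d x]))
| KaehlerBase a : kaehler_rel [d (phi a)].

Inductive kaehler_span : F -> Prop :=
| KaehlerSpan0 : kaehler_span 0
| KaehlerSpanS b r v :
    kaehler_rel r -> kaehler_span v -> kaehler_span (b *: r + v).

Lemma kaehler_spanL b u v :
  kaehler_span u -> kaehler_span v -> kaehler_span (b *: u + v).
Proof.
move=> hu hv; elim: hu => [|c r w hr _ IH]; first by rewrite scaler0 add0r.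
by rewrite scalerDr scalerA -addrA; apply: KaehlerSpanS.
Qed.

Definition kaehler_sub : {pred F} := fun v => `[< kaehler_span v >].

Lemma kaehler_sub_zmod : zmod_closed kaehler_sub.
Proof.
split=> [|u v /asboolP hu /asboolP hv]; apply/asboolP.
  exact: KaehlerSpan0.
by rewrite addrC -scaleN1r; apply: kaehler_spanL.
Qed.

HB.instance Definition _ :=
  GRing.isZmodClosed.Build F kaehler_sub kaehler_sub_zmod.

(* Omega^1_{B/A}, for B an A-algebra through phi *)
Definition kaehler := Quotient.quot kaehler_sub.

HB.instance Definition _ := Quotient.on kaehler.
HB.instance Definition _ := Choice.on kaehler.
HB.instance Definition _ := GRing.Zmodule.on kaehler.

Local Notation proj u := (\pi_kaehler u : kaehler).

Lemma kaehler_eq u v : proj u = proj v <-> kaehler_span (u - v).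
Proof.
have -> : kaehler_span (u - v) <-> (u - v \in kaehler_sub).
  by split=> /asboolP.
rewrite Quotient.idealrBE; split=> [h|/eqP //]; exact/eqP.
Qed.

Lemma kaehler_projB u v : proj (u - v) = proj u - proj v.
Proof. by rewrite !piE. Qed.

Lemma kaehler_projD u v : proj (u + v) = proj u + proj v.
Proof. by rewrite !piE. Qed.

Definition kaehler_scale (b : B) (w : kaehler) : kaehler := proj (b *: repr w).

Lemma kaehler_scaleE b u : kaehler_scale b (proj u) = proj (b *: u).
Proof.
apply/kaehler_eq; rewrite -scalerBr -[_ *: _]addr0.
apply: kaehler_spanL; last exact: KaehlerSpan0.
by apply/kaehler_eq; rewrite reprK.
Qed.

Lemma kaehler_scaleA b c w :
  kaehler_scale b (kaehler_scale c w) = kaehler_scale (b * c) w.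
Proof.
by rewrite -[w]reprK (kaehler_scaleE c) kaehler_scaleE kaehler_scaleE scalerA.
Qed.

Lemma kaehler_scale1 w : kaehler_scale 1 w = w.
Proof. by rewrite -[w]reprK kaehler_scaleE scale1r. Qed.

Lemma kaehler_scaleDr b : {morph kaehler_scale b : u v / u + v}.
Proof.
move=> u v; rewrite -[u]reprK -[v]reprK -kaehler_projD !kaehler_scaleE.
by rewrite scalerDr kaehler_projD.
Qed.

Lemma kaehler_scaleDl w : {morph kaehler_scale^~ w : b c / b + c}.
Proof.
by move=> b c; rewrite -[w]reprK !kaehler_scaleE scalerDl kaehler_projD.
Qed.

HB.instance Definition _ := GRing.Zmodule_isLmodule.Build B kaehler
  kaehler_scaleA kaehler_scale1 kaehler_scaleDr
  (fun w b c => kaehler_scaleDl w b c).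

Definition kaehler_d (x : B) : kaehler := proj [d x].

Lemma kaehler_rel0 r : kaehler_rel r -> proj r = 0.
Proof.
move=> hr; rewrite -(subrr (proj r)) -kaehler_projB; apply/kaehler_eq.
by rewrite subrr subr0 -[r]scale1r -[_ *: _]addr0;
  apply: KaehlerSpanS hr KaehlerSpan0.
Qed.

Lemma kaehler_d_derivation : derivation kaehler_d.
Proof.
split=> [x y|x y|a].
- apply/subr0_eq; rewrite -kaehler_projD -kaehler_projB.
  exact/kaehler_rel0/KaehlerAdd.
- apply/subr0_eq; rewrite /GRing.scale /= !kaehler_scaleE.
  by rewrite -kaehler_projD -kaehler_projB; exact/kaehler_rel0/KaehlerMul.
- exact/kaehler_rel0/KaehlerBase.
Qed.

Lemma kaehler_d_universal (M : lmodType B) (D : B -> M) :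
  derivation D ->
  exists2 f : {linear kaehler -> M}, (forall x, D x = f (kaehler_d x)) &
    forall f' : {linear kaehler -> M}, (forall x, D x = f' (kaehler_d x)) ->
    f' =1 f.
Proof.
case=> DD DM D0; pose l : {linear F -> M} := free_lift D.
have l0 v : kaehler_span v -> l v = 0.
  elim=> [|b r w hr _ IH]; first exact: raddf0.
  rewrite linearP IH addr0; suff -> : l r = 0 by rewrite scaler0.
  case: hr => [x y|x y|a]; rewrite ?raddfB ?raddfD /= ?linearZ /= ?free_lift_gen.
  - by rewrite DD -opprD subrr.
  - by rewrite DM !scalerN -opprD subrr.
  - exact: D0.
pose f (w : kaehler) : M := l (repr w).
have fE u : f (proj u) = l u.
  apply/subr0_eq; rewrite -raddfB; apply: l0.
  by apply/kaehler_eq; rewrite reprK.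
have f_lin : linear f.
  move=> b u v; rewrite -[u]reprK -[v]reprK {1}/GRing.scale /= kaehler_scaleE.
  by rewrite -kaehler_projD !fE linearP.
pose fL := GRing.isLinear.Build B kaehler M _ f f_lin.
pose fl : {linear kaehler -> M} := HB.pack f fL.
exists fl => [x|f' hf' w]; first by rewrite [RHS]fE [RHS]free_lift_gen.
rewrite -[w]reprK [RHS]fE {1}[repr w]free_sum.
have -> : proj (\sum_(i <- monalg.msupp (repr w)) monalg.mcoeff i (repr w) *: [d i]) =
  \sum_(i <- monalg.msupp (repr w)) monalg.mcoeff i (repr w) *: kaehler_d i.
  elim/big_ind2 : _ => [|u1 u2 v1 v2 h1 h2|i _]; first by rewrite !piE.
    by rewrite kaehler_projD h1 h2.
  by rewrite -[RHS]/(kaehler_scale _ _) kaehler_scaleE.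
by rewrite raddf_sum; apply: eq_bigr => i _ /=; rewrite linearZ /= -hf'.
Qed.

End Kaehler.

(* monalg declares this notation as well, for its own multinomials *)
Local Notation "{ 'mpoly' R [ n ] }" := (mpoly n R) : type_scope.

(* A variety in A^N is given by its set of K-points. *)
Definition avar (K : fieldType) (N : nat) := ('I_N -> K) -> Prop.

Section CoordinateRing.
Variables (K : fieldType) (N : nat).
Implicit Type X : avar K N.

Definition vanishing X : {pred {mpoly K[N]}} :=
  fun p => `[< forall x, X x -> p.@[x] = 0 >].

Lemma vanishingP X p :
  reflect (forall x, X x -> p.@[x] = 0) (p \in vanishing X).
Proof. exact: asboolP. Qed.

Lemma vanishing_zmod X : zmod_closed (vanishing X).
Proof.
split=> [|p q /vanishingP hp /vanishingP hq]; apply/vanishingP => x Xx.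
  exact: meval0.
by rewrite mevalB hp // hq // subrr.
Qed.

HB.instance Definition _ X :=
  GRing.isZmodClosed.Build {mpoly K[N]} (vanishing X) (vanishing_zmod X).

Lemma vanishingMl X p q : q \in vanishing X -> p * q \in vanishing X.
Proof.
by move=> /vanishingP hq; apply/vanishingP => x Xx; rewrite mevalM hq ?mulr0.
Qed.

(* K[x_1, ..., x_N] / I(X); {ideal_quot _} is not usable for the ring
   structure, because it requires a proper ideal, i.e. X nonempty. *)
Definition coord_ring X := Quotient.quot (vanishing X).

HB.instance Definition _ X := Quotient.on (coord_ring X).
HB.instance Definition _ X := Choice.on (coord_ring X).
HB.instance Definition _ X := GRing.Zmodule.on (coord_ring X).

Section Ring.
Variable X : avar K N.

Definition coord (p : {mpoly K[N]}) : coord_ring X := \pi_(coord_ring X) p.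

Lemma coord_eq p q : (coord p = coord q) <-> (p - q \in vanishing X).
Proof.
rewrite /coord; split=> [|h].
  by move=> h; rewrite Quotient.idealrBE; apply/eqP; exact: h.
by apply/eqP; rewrite -Quotient.idealrBE.
Qed.

Lemma coordK (a : coord_ring X) : coord (repr a) = a.
Proof. exact: reprK. Qed.

Lemma coordB : {morph coord : p q / p - q}.
Proof. by move=> p q; rewrite /coord !piE. Qed.

HB.instance Definition _ := GRing.isZmodMorphism.Build _ _ coord coordB.

Definition coord_one := coord 1.
Definition coord_mul (a b : coord_ring X) := coord (repr a * repr b).

Lemma coord_mulE p q : coord_mul (coord p) (coord q) = coord (p * q).
Proof.
apply/coord_eq.
have hp : repr (coord p) - p \in vanishing X by apply/coord_eq; rewrite coordK.
have hq : repr (coord q) - q \in vanishing X by apply/coord_eq; rewrite coordK.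
have -> : repr (coord p) * repr (coord q) - p * q =
  repr (coord p) * (repr (coord q) - q) + q * (repr (coord p) - p).
  by rewrite !mulrBr addrA [q * repr _]mulrC subrK [q * p]mulrC.
by rewrite rpredD ?vanishingMl.
Qed.

Lemma coord_mulA : associative coord_mul.
Proof.
by move=> a b c; rewrite -[a]coordK -[b]coordK -[c]coordK !coord_mulE mulrA.
Qed.

Lemma coord_mulC : commutative coord_mul.
Proof. by move=> a b; rewrite /coord_mul mulrC. Qed.

Lemma coord_mul1 : left_id coord_one coord_mul.
Proof. by move=> a; rewrite -[a]coordK coord_mulE mul1r. Qed.

Lemma coord_mulDl : left_distributive coord_mul +%R.
Proof.
move=> a b c; rewrite -[a]coordK -[b]coordK -[c]coordK -raddfD.
by rewrite !coord_mulE mulrDl raddfD.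
Qed.

HB.instance Definition _ := GRing.Zmodule_isComPzRing.Build (coord_ring X)
  coord_mulA coord_mulC coord_mul1 coord_mulDl.

Lemma coord_monoid : monoid_morphism coord.
Proof. by split=> // p q; rewrite [RHS]coord_mulE. Qed.

HB.instance Definition _ := GRing.isMonoidMorphism.Build _ _ coord coord_monoid.

End Ring.
End CoordinateRing.

Section Morphisms.
Variables (K : fieldType) (N M : nat).
Implicit Types (g : M.-tuple {mpoly K[N]}) (X : avar K N) (Y : avar K M).

Definition eval_tuple g (x : 'I_N -> K) : 'I_M -> K :=
  fun i => (tnth g i).@[x].

Record avar_morphism X Y := AvarMorphism {
  components :> M.-tuple {mpoly K[N]};
  _ : forall x, X x -> Y (eval_tuple components x)
}.

Section Pullback.
Variables (X : avar K N) (Y : avar K M) (g : avar_morphism X Y).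

Definition pullback (a : coord_ring Y) : coord_ring X :=
  coord X (repr a \mPo g).

Lemma pullbackE p : pullback (coord Y p) = coord X (p \mPo g).
Proof.
apply/coord_eq; rewrite -comp_mpolyB; apply/vanishingP => x Xx.
rewrite comp_mpoly_meval.
have /vanishingP : repr (coord Y p) - p \in vanishing Y.
  by apply/coord_eq; rewrite coordK.
by apply; case: g Xx => h hP /hP.
Qed.

Lemma pullbackB : {morph pullback : a b / a - b}.
Proof.
move=> a b; rewrite -[a]coordK -[b]coordK -raddfB !pullbackE.
by rewrite raddfB /= raddfB.
Qed.

Lemma pullback_monoid : monoid_morphism pullback.
Proof.
split; first by rewrite -[1](rmorph1 (coord Y)) pullbackE rmorph1 rmorph1.
move=> a b; rewrite -[a]coordK -[b]coordK -rmorphM !pullbackE.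
by rewrite rmorphM /= rmorphM.
Qed.

HB.instance Definition _ := GRing.isZmodMorphism.Build _ _ pullback pullbackB.
HB.instance Definition _ :=
  GRing.isMonoidMorphism.Build _ _ pullback pullback_monoid.

End Pullback.
End Morphisms.

Section DividedPolynomials.
Variable R : comUnitRingType.

(* x^(m) + s_1 x^(m-1) + ... + s_m, with x^(k) = x^k / k!; s_i is s (i - 1) *)
Definition divided_poly m (s : 'I_m -> R) : {poly R} :=
  (m`!%:R^-1) *: 'X^m +
  \sum_(i < m) (s i / (m - i.+1)`!%:R) *: 'X^(m - i.+1).

Definition divided_coords m (F : {poly R}) : 'I_m -> R :=
  fun i => F`_(m - i.+1) * (m - i.+1)`!%:R.

Arguments divided_coords m F : clear implicits.

(* The primitive of p that vanishes at t; the term i = 0 is 0 since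
   0%:R^-1 = 0. *)
Definition primitive_at (t : R) (p : {poly R}) : {poly R} :=
  let q := \poly_(i < (size p).+1) (p`_i.-1 / i%:R) in q - q.[t]%:P.

Lemma divided_poly_eq m (s1 s2 : 'I_m -> R) :
  s1 =1 s2 -> divided_poly s1 = divided_poly s2.
Proof.
by move=> h; congr (_ + _); apply: eq_bigr => i _; rewrite h.
Qed.

Lemma coef_divided_poly m (s : 'I_m -> R) (i : 'I_m) :
  (divided_poly s)`_(m - i.+1) = s i / (m - i.+1)`!%:R.
Proof.
have lt_im := ltn_ord i.
rewrite coefD coefZ coefXn ltn_eqF ?mulr0 ?add0r; last first.
  by rewrite ltn_subrL (leq_trans _ lt_im).
rewrite coef_sum (bigD1 i) //= coefZ coefXn eqxx mulr1 big1 ?addr0 // => j ji.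
rewrite coefZ coefXn; case: eqP => [|_]; last by rewrite mulr0.
move=> e; case/eqP: ji; apply/val_inj/succn_inj => /=.
by rewrite -(subKn (ltn_ord j)) -e subKn.
Qed.

Lemma coef_divided_polym m (s : 'I_m -> R) :
  (divided_poly s)`_m = (m`!%:R^-1).
Proof.
rewrite coefD coefZ coefXn eqxx mulr1 coef_sum big1 ?addr0 // => i _.
by rewrite coefZ coefXn gtn_eqF ?mulr0 // ltn_subrL (leq_trans _ (ltn_ord i)).
Qed.

Lemma size_divided_poly m (s : 'I_m -> R) : (size (divided_poly s) <= m.+1)%N.
Proof.
rewrite (leq_trans (size_polyD _ _)) // geq_max.
rewrite (leq_trans (size_scale_leq _ _)) ?size_polyXn //=.
apply: (leq_trans (size_sum _ _ _)); apply/bigmax_leqP => i _.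
by rewrite (leq_trans (size_scale_leq _ _)) // size_polyXn ltnS leq_subr.
Qed.

Lemma divided_coordsK m (F : {poly R}) :
  (forall k, (k`!%:R : R) \is a GRing.unit) ->
  (size F <= m.+1)%N -> F`_m = m`!%:R^-1 -> divided_poly (divided_coords m F) = F.
Proof.
move=> fact_unit sF Fm; apply/polyP => j.
have [mj|jm] := ltnP m j.
  rewrite !nth_default ?(leq_trans sF) //.
  exact: leq_trans (size_divided_poly _) mj.
move: jm; rewrite leq_eqVlt => /predU1P[->|jm].
  by rewrite coef_divided_polym.
have -> : j = (m - (rev_ord (Ordinal jm)).+1)%N.
  by rewrite /= subnSK // subKn // ltnW.
by rewrite coef_divided_poly mulrK.
Qed.

End DividedPolynomials.

Arguments divided_coords {R} m F _.

Section DividedMorphism.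
Variables (R S : comUnitRingType) (f : {rmorphism R -> S}).
Hypothesis natr_unit : forall k : nat, (k.+1%:R : R) \is a GRing.unit.

Let fact_unit k : (k`!%:R : R) \is a GRing.unit.
Proof. by have := natr_unit (k`!).-1; rewrite prednK ?fact_gt0. Qed.

Lemma map_divided_poly m (s : 'I_m -> R) :
  map_poly f (divided_poly s) = divided_poly (f \o s).
Proof.
rewrite rmorphD /= map_polyZ map_polyXn rmorphV // rmorph_nat; congr (_ + _).
rewrite rmorph_sum; apply: eq_bigr => i _.
by rewrite /= map_polyZ map_polyXn rmorphM /= rmorphV ?fact_unit // rmorph_nat.
Qed.

Lemma map_primitive_at t p :
  map_poly f (primitive_at t p) = primitive_at (f t) (map_poly f p).
Proof.
rewrite /primitive_at rmorphB /= map_polyC /= -horner_map.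
suff -> : map_poly f (\poly_(i < (size p).+1) (p`_i.-1 / i%:R)) =
  \poly_(i < (size (map_poly f p)).+1) ((map_poly f p)`_i.-1 / i%:R) by [].
apply/polyP => i; rewrite coef_map [RHS]coef_poly coef_map [in LHS]coef_poly.
case: i => [|i]; first by rewrite /= !mulr0n !invr0 !mulr0 rmorph0.
have -> : f (p`_i.+1.-1) / i.+1%:R = f (p`_i / i.+1%:R).
  by rewrite rmorphM /= rmorphV // rmorph_nat.
rewrite !ltnS; case: ltnP => hi; case: ltnP => hi' //.
- by rewrite /= rmorphM /= -coef_map nth_default // mul0r.
- by rewrite [p`_i]nth_default // mul0r.
- by rewrite /= rmorph0.
Qed.

Lemma map_divided_coords m F :
  f \o divided_coords m F =1 divided_coords m (map_poly f F).
Proof.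
by move=> i /=; rewrite /divided_coords rmorphM rmorph_nat coef_map.
Qed.

End DividedMorphism.

Section Varieties.
Variable K : fieldType.

Definition Sigma (m k : nat) : avar K m :=
  fun s => exists c, ('X - c%:P) ^+ k %| divided_poly s.

Arguments Sigma m k : clear implicits.

Definition Discriminant (n : nat) : avar K n := Sigma n 2.

(* A^n x A^1 is A^(n+1), with t as the last coordinate. *)
Definition pt_poly n (y : 'I_n.+1 -> K) : {poly K} :=
  divided_poly (fun i : 'I_n => y (widen_ord (leqnSn n) i)).

Definition pt_root n (y : 'I_n.+1 -> K) : K := y ord_max.

Definition NormDiscriminant (n : nat) : avar K n.+1 :=
  fun y => root (pt_poly y) (pt_root y) /\ root (pt_poly y)^`() (pt_root y).

Arguments Discriminant n : clear implicits.
Arguments NormDiscriminant n : clear implicits.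

Lemma dvdp_XsubC2 (p : {poly K}) c :
  root p c -> root p^`() c -> ('X - c%:P) ^+ 2 %| p.
Proof.
move=> /factor_theorem[q ->]; rewrite derivM derivXsubC mulr1 /root.
rewrite hornerD hornerM hornerXsubC subrr mulr0 add0r => /factor_theorem[r ->].
by rewrite -mulrA dvdp_mull.
Qed.

Definition forget_root_tuple n : n.-tuple {mpoly K[n.+1]} :=
  [tuple 'X_(widen_ord (leqnSn n) i) | i < n].

Lemma forget_root_subproof n (y : 'I_n.+1 -> K) :
  NormDiscriminant n y -> Discriminant n (eval_tuple (forget_root_tuple n) y).
Proof.
case=> h0 h1; exists (pt_root y).
rewrite (@divided_poly_eq _ _ _ (fun i : 'I_n => y (widen_ord (leqnSn n) i))).
  exact: dvdp_XsubC2.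
by move=> i; rewrite /eval_tuple tnth_mktuple mevalXU.
Qed.

(* (f, t) |-> f *)
Definition forget_root n :
    avar_morphism (NormDiscriminant n) (Discriminant n) :=
  AvarMorphism (@forget_root_subproof n).

(* The universal f integrated n - 3 times, each time with value 0 at t; the
   coefficients are polynomials in the coordinates (s_1, ..., s_n, t). *)
Definition universal_lift (n : nat) : {poly {mpoly K[n.+1]}} :=
  iter (n - 3) (primitive_at 'X_ord_max)
    (divided_poly (fun i : 'I_n => 'X_(widen_ord (leqnSn n) i))).

Definition normalization_tuple n : (2 * n - 3).-tuple {mpoly K[n.+1]} :=
  [tuple divided_coords (2 * n - 3) (universal_lift n) i | i < 2 * n - 3].

Hypothesis char0 : [pchar K] =i pred0.

Let natK k : (k.+1%:R : K) != 0.
Proof. by rewrite (iffLR (pcharf0P K) char0). Qed.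

Lemma primitive_at_deriv t (p : {poly K}) : (primitive_at t p)^`() = p.
Proof.
rewrite derivB derivC subr0; apply/polyP => i; rewrite coef_deriv coef_poly.
rewrite ltnS /=; case: ltnP => hi; last by rewrite mul0rn nth_default.
by rewrite /= -[LHS]mulr_natr divfK.
Qed.

Lemma size_primitive_at t (p : {poly K}) :
  (size (primitive_at t p) <= (size p).+1)%N.
Proof.
rewrite (leq_trans (size_polyD _ _)) // geq_max size_poly size_polyN.
by rewrite (leq_trans (size_polyC_leq1 _)).
Qed.

Lemma root_primitive_at t (p : {poly K}) : root (primitive_at t p) t.
Proof. by rewrite /root hornerD hornerN hornerC subrr. Qed.

Lemma dvdp_deriv_root k (q : {poly K}) t :
  root q t -> ('X - t%:P) ^+ k %| q^`() -> ('X - t%:P) ^+ k.+1 %| q.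
Proof.
have [->|q0] := eqVneq q 0; first by rewrite dvdp0.
have [j [r]] := multiplicity_XsubC q t; rewrite q0 /= => rt ->.
rewrite rootM (negPf rt) /=; case: j => [|j]; first by rewrite expr0 (negPf (root1 _)).
rewrite derivM deriv_exp derivXsubC mul1r /= => _ dvd_q'.
rewrite dvdp_mull // dvdp_exp2l // ltnS leqNgt; apply: contraNN rt => lt_jk.
have /dvdp_trans := dvdp_exp2l ('X - t%:P) lt_jk; move/(_ _ dvd_q').
have -> : r^`() * ('X - t%:P) ^+ j.+1 + r * (('X - t%:P) ^+ j *+ j.+1) =
  ('X - t%:P) ^+ j * (r^`() * ('X - t%:P) + r *+ j.+1).
  by rewrite mulrDr exprSr !mulrnAr mulrA mulrAC [r^`() * _ * _]mulrC mulrA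
    [r * _]mulrC.
rewrite exprSr dvdp_mul2l ?expf_neq0 ?polyXsubC_eq0 // dvdp_XsubCl /root.
rewrite hornerD hornerM hornerXsubC subrr mulr0 add0r hornerMn -mulr_natr.
by rewrite mulf_eq0 (negPf (natK j)) orbF.
Qed.

Section IteratedPrimitive.
Variables (t : K) (f : {poly K}).
Local Notation lift k := (iter k (primitive_at t) f).

Lemma iter_primitive_deriv k : (lift k)^`(k) = f.
Proof. by elim: k => // k IH; rewrite derivSn iterS primitive_at_deriv. Qed.

Lemma iter_primitive_size k m : (size f <= m)%N -> (size (lift k) <= k + m)%N.
Proof.
move=> fm; elim: k => // k IH; rewrite iterS.
by rewrite (leq_trans (size_primitive_at _ _)).
Qed.

Lemma iter_primitive_dvdp k m :
  ('X - t%:P) ^+ m %| f -> ('X - t%:P) ^+ (k + m) %| lift k.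
Proof.
move=> fm; elim: k => // k IH; rewrite iterS addSn.
by apply: dvdp_deriv_root; rewrite ?root_primitive_at ?primitive_at_deriv.
Qed.

Lemma iter_primitive_coef k m :
  f`_m = m`!%:R^-1 -> (lift k)`_(k + m) = (k + m)`!%:R^-1.
Proof.
have natK' p : (0 < p)%N -> (p%:R : K) != 0 by case: p.
have fc : (0 < (k + m) ^_ k)%N by rewrite ffact_gt0 leq_addr.
rewrite -{1}(iter_primitive_deriv k) coef_derivn => h.
rewrite -[LHS](mulfK (natK' _ fc)) mulr_natr h -invfM -natrM mulnC.
by rewrite -[X in (_ * X`!)%N](addKn k) ffact_fact ?leq_addr.
Qed.
End IteratedPrimitive.

Lemma derivn_eq0_size k (p : {poly K}) : p^`(k) = 0 -> (size p <= k)%N.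
Proof.
move=> p0; apply/leq_sizeP => j kj.
have := congr1 (fun q : {poly K} => q`_(j - k)) p0.
rewrite coef_derivn coef0 subnKC // -mulr_natr => /eqP.
rewrite mulf_eq0 => /orP[/eqP //|].
by rewrite -ffact_gt0 in kj; case: (_ ^_ _) kj => // l _; rewrite (negPf (natK l)).
Qed.

Lemma normalizationE n (y : 'I_n.+1 -> K) : (3 <= n)%N ->
  divided_poly (eval_tuple (normalization_tuple n) y) =
  iter (n - 3) (primitive_at (pt_root y)) (pt_poly y).
Proof.
move=> n3; set F := iter _ _ _.
have unitK k : (k.+1%:R : K) \is a GRing.unit by rewrite unitfE natK.
have unitM k : (k.+1%:R : {mpoly K[n.+1]}) \is a GRing.unit.
  by rewrite -(rmorph_nat (@mpolyC n.+1 K)); apply: rmorph_unit.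
have eF : map_poly (meval y) (universal_lift n) = F.
  rewrite /universal_lift /F; elim: (n - 3)%N => [|k IH].
    rewrite /= map_divided_poly //; apply: divided_poly_eq => i /=.
    by rewrite mevalXU.
  by rewrite !iterS map_primitive_at // IH /= mevalXU.
have mE : (2 * n - 3 = n - 3 + n)%N by rewrite mul2n -addnn addnBAC.
rewrite (@divided_poly_eq _ _ _ (divided_coords (2 * n - 3) F)); last first.
  by move=> i; rewrite /eval_tuple tnth_mktuple -eF -map_divided_coords.
apply: divided_coordsK => [k||].
- by rewrite unitfE; have := fact_gt0 k; case: (k`!).
- by rewrite mE -addnS; apply: iter_primitive_size; exact: size_divided_poly.
- by rewrite mE; apply: iter_primitive_coef; exact: coef_divided_polym.
Qed.

Section Normalization.
Variables (n : nat) (n3 : (3 <= n)%N).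

Lemma normalization_spec (y : 'I_n.+1 -> K) : NormDiscriminant n y ->
  let F := divided_poly (eval_tuple (normalization_tuple n) y) in
  F^`(n - 3) = pt_poly y /\ ('X - (pt_root y)%:P) ^+ (n - 1) %| F.
Proof.
case=> f0 f1; rewrite /= normalizationE //; split.
  exact: iter_primitive_deriv.
have -> : (n - 1 = n - 3 + 2)%N by rewrite -(subnK n3) addnK -addnBA.
exact/iter_primitive_dvdp/dvdp_XsubC2.
Qed.

Lemma normalization_unique (y : 'I_n.+1 -> K) (z : 'I_(2 * n - 3) -> K) :
  NormDiscriminant n y ->
  (divided_poly z)^`(n - 3) = pt_poly y ->
  ('X - (pt_root y)%:P) ^+ (n - 1) %| divided_poly z ->
  z =1 eval_tuple (normalization_tuple n) y.
Proof.
move=> hy; have [<-] := normalization_spec hy; set z' := eval_tuple _ _.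
set p := 'X - _ => z'dvd /eqP; rewrite -subr_eq0 -linearB /= => /eqP d0 zdvd i.
suff zz' : divided_poly z = divided_poly z'.
  have := congr1 (fun q : {poly K} => q`_(2 * n - 3 - i.+1)) zz'.
  rewrite !coef_divided_poly => /(congr1 (fun x => x * (2 * n - 3 - i.+1)`!%:R)).
  by rewrite !divfK //; have := fact_gt0 (2 * n - 3 - i.+1); case: (_`!).
apply/eqP; rewrite -subr_eq0; apply: contraTT isT => nz.
have := dvdp_leq nz (dvdp_sub zdvd z'dvd).
rewrite size_exp_XsubC leqNgt ltnS => /negP[].
by rewrite (leq_trans (derivn_eq0_size d0)) // leq_sub2l.
Qed.

Lemma normalization_subproof (y : 'I_n.+1 -> K) : NormDiscriminant n y ->
  Sigma (2 * n - 3) (n - 1) (eval_tuple (normalization_tuple n) y).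
Proof. by case/normalization_spec => _ h; exists (pt_root y). Qed.

(* (f, t) |-> the polynomial described by normalization_spec and
   normalization_unique *)
Definition normalization :
    avar_morphism (NormDiscriminant n) (Sigma (2 * n - 3) (n - 1)) :=
  AvarMorphism normalization_subproof.

End Normalization.
End Varieties.

Arguments Sigma K m k : clear implicits.
Arguments Discriminant K n : clear implicits.
Arguments NormDiscriminant K n : clear implicits.
Arguments pt_poly {K n} y.
Arguments pt_root {K n} y.

Section OpenSwallowtails.
Variables (K : fieldType) (n : nat).

Definition geometric_open_swallowtail : avar K (2 * n - 3) :=
  Sigma K (2 * n - 3) (n - 1).

(* As a subset of the coordinate ring of the normalized discriminant, which is
   an algebra over the coordinate ring of the discriminant through
   pullback (forget_root K n). *)
Definition algebraic_open_swallowtail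
    (b : coord_ring (NormDiscriminant K n)) : Prop :=
  kaehler_d (pullback (forget_root K n)) b = 0.

End OpenSwallowtails.
Arguments geometric_open_swallowtail K n : clear implicits.

(* Main.v *)
Require Import Defs.
From HB Require Import structures.
From mathcomp Require Import all_boot all_order all_algebra.
From mathcomp Require Import generic_quotient.
From mathcomp Require Import mpoly ring.

Set Implicit Arguments.
Unset Strict Implicit.
Unset Printing Implicit Defensive.

Import GRing.Theory.
Local Open Scope ring_scope.
Local Open Scope quotient_scope.

Local Notation "{ 'mpoly' R [ n ] }" := (mpoly n R) : type_scope.

(** Write d = n - 2 and A = K[s_1, ..., s_d]. A polynomial f with a double root
    at t is the second iterated primitive, normalized to vanish at t, of its
    second derivative h = x^(d) + s_1 x^(d-1) + ... + s_d, which is arbitrary.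
    Hence (s_1, ..., s_d, t) are free coordinates on the normalized
    discriminant, whose coordinate ring becomes A[t]. Both subrings turn out to
    be R = {q in A[t] : h(t) divides dq/dt}.

    For the algebraic swallowtail, d s_i = 0 for i <= d in the module of
    differentials, so that d q = (dq/dt) dt. The remaining two coordinates of f
    are, up to units, the integrals from 0 to t of h(u) and of u h(u); their
    differentials vanish, which is the single relation h(t) dt = 0. Hence
    d q = 0 exactly when h divides dq/dt (kaehler_d_coord).

    For the geometric swallowtail, the lift F of (f, t) is the (d + 1)-st
    iterated primitive of h normalized at t. Differentiating in the base point
    gives dF/dt = - h(t) (x - t)^d / d!, so that the coefficients of F which are
    not among the s_i are, up to units, J(t^j) = integral from 0 to t of
    u^j h(u) du for 0 <= j <= d (coef_iter_primitive_integral). They visibly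
    lie in R. Conversely an element of R is its constant term in A plus some
    J(r), so it remains to generate J(t^j) for j > d. Integration by parts gives
    J(1) J(t^k) = J(t^k J(1) + J(t^k)), where the argument of J on the right
    has degree d + 1 + k in t with a unit as leading coefficient; this expresses
    J(t^(d+1+k)) through J(1), J(t^k) and J(t^i) with i < d + 1 + k
    (weighted_integral_gen). *)

(** * Primitives of polynomials *)

(** Encodes that R is a Q-algebra; polynomial rings inherit it. *)
Definition natr_units (R : comUnitRingType) :=
  forall k : nat, (k.+1%:R : R) \is a GRing.unit.

Lemma fact_unit (R : comUnitRingType) k :
  natr_units R -> (k`!%:R : R) \is a GRing.unit.
Proof. by move=> /(_ (k`!).-1); rewrite prednK ?fact_gt0. Qed.

Lemma natr_units_morph (R S : comUnitRingType) (f : {rmorphism R -> S}) :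
  natr_units R -> natr_units S.
Proof. by move=> uR k; rewrite -(rmorph_nat f); apply: rmorph_unit. Qed.

Section Primitives.
Variable R : comUnitRingType.
Hypothesis uR : natr_units R.
Implicit Types (p q : {poly R}) (t : R).

Lemma deriv_eq_horner t p q : p^`() = q^`() -> p.[t] = q.[t] -> p = q.
Proof.
move=> /eqP; rewrite -subr_eq0 -derivB => /eqP d0 e.
suff pqC : p - q = ((p - q)`_0)%:P.
  apply/eqP; rewrite -subr_eq0 pqC; apply/eqP.
  by rewrite -[(_)`_0](hornerC _ t) -pqC hornerD hornerN e subrr.
apply/polyP => -[|i]; rewrite coefC //=.
have := congr1 (fun r : {poly R} => r`_i) d0.
rewrite coef_deriv coef0 -[LHS]mulr_natr => h.
by rewrite -[LHS](mulrK (uR i)) h mul0r.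
Qed.

Lemma coef_primitive_at t p i : (primitive_at t p)`_i.+1 = p`_i / i.+1%:R.
Proof.
rewrite /primitive_at coefB coefC subr0 coef_poly ltnS.
by case: ltnP => // le; rewrite nth_default ?mul0r.
Qed.

Lemma deriv_primitive_at t p : (primitive_at t p)^`() = p.
Proof.
apply/polyP => i.
by rewrite coef_deriv coef_primitive_at -[LHS]mulr_natr mulrVK.
Qed.

Lemma horner_primitive_at t p : (primitive_at t p).[t] = 0.
Proof. by rewrite hornerD hornerN hornerC subrr. Qed.

Lemma primitive_at_unique t p q :
  q^`() = p -> q.[t] = 0 -> primitive_at t p = q.
Proof.
move=> dq q0; apply: (@deriv_eq_horner t); first by rewrite deriv_primitive_at.
by rewrite horner_primitive_at.
Qed.

Lemma size_primitive_at_leq t p : (size (primitive_at t p) <= (size p).+1)%N.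
Proof.
by apply/leq_sizeP => -[//|i lt]; rewrite coef_primitive_at nth_default ?mul0r.
Qed.

Lemma coef_iter_primitive t p k i :
  (iter k (primitive_at t) p)`_(k + i) * (k + i)`!%:R = p`_i * i`!%:R.
Proof.
elim: k => // k IH; rewrite iterS addSn coef_primitive_at factS natrM mulrA.
by rewrite mulrVK.
Qed.

Lemma size_iter_primitive t p k :
  (size (iter k (primitive_at t) p) <= k + size p)%N.
Proof.
elim: k => // k IH; rewrite iterS.
by rewrite (leq_trans (size_primitive_at_leq _ _)).
Qed.

Lemma coef_iter_primitive0 p k i :
  (i < k)%N -> (iter k (primitive_at 0) p)`_i = 0.
Proof.
elim: k i => // k IH [_|i lt_ik]; last first.
  by rewrite iterS coef_primitive_at IH ?mul0r.
by rewrite -horner_coef0 iterS horner_primitive_at.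
Qed.

End Primitives.

(** * Integrals against a fixed weight *)

Section Weighted.
Variable A : idomainType.
Hypothesis uA : natr_units A.
Variable h : {poly A}.
Implicit Types p q : {poly A}.

(** The integral of p h from 0 to the variable. *)
Definition weighted_integral p := primitive_at 0 (p * h).
Local Notation J := weighted_integral.

Lemma weighted_integralD p q : J (p + q) = J p + J q.
Proof.
apply: (primitive_at_unique uA).
  by rewrite derivD !(deriv_primitive_at uA) mulrDl.
by rewrite hornerD !horner_primitive_at addr0.
Qed.

Lemma weighted_integralZ a p : J (a *: p) = a *: J p.
Proof.
apply: (primitive_at_unique uA).
  by rewrite derivZ (deriv_primitive_at uA) scalerAl.
by rewrite hornerZ horner_primitive_at mulr0.
Qed.

Lemma weighted_integral0 : J 0 = 0.
Proof. by rewrite -[in LHS](scale0r 0) weighted_integralZ scale0r. Qed.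

(** Integration by parts; the right-hand side is again an integral against h,
    so the integrals against h are closed under products. *)
Lemma weighted_integralM p q : J p * J q = J (J p * q + p * J q).
Proof.
apply/esym/(primitive_at_unique uA).
  rewrite derivM !(deriv_primitive_at uA) [RHS]mulrDl addrC.
  by rewrite mulrA [p * h * _]mulrAC.
by rewrite hornerM !horner_primitive_at mul0r.
Qed.

Lemma weighted_integral_deriv p r :
  p^`() = r * h -> p = (p.[0])%:P + J r.
Proof.
move=> dp; rewrite [J _](@primitive_at_unique _ uA _ _ (p - (p.[0])%:P)).
- by rewrite addrC subrK.
- by rewrite derivB derivC subr0.
- by rewrite hornerD hornerN hornerC subrr.
Qed.

Variable d : nat.
Hypotheses (size_h : size h = d.+1) (lead_h : h`_d \is a GRing.unit).

(** A subring containing A and J(x^j) for j <= d contains J(x^j) for every j, by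
    strong induction: for j = d + 1 + k the product J(1) J(x^k) is J(W) with W
    of degree j and invertible leading coefficient, which leaves J(x^j) after
    removing the lower terms of W. *)
Lemma weighted_integral_gen (Q : {poly A} -> Prop) :
  (forall c, Q c%:P) ->
  (forall p q, Q p -> Q q -> Q (p + q)) ->
  (forall p q, Q p -> Q q -> Q (p * q)) ->
  (forall j, (j <= d)%N -> Q (J 'X^j)) ->
  forall r, Q (J r).
Proof.
move=> QC QD QM QX.
have QZ c p : Q p -> Q (c *: p) by rewrite -mul_polyC; apply: QM.
have Qsum N (a : nat -> A) : (forall i, (i < N)%N -> Q (J 'X^i)) ->
    Q (J (\sum_(i < N) a i *: 'X^i)).
  move=> QN; rewrite (big_morph J weighted_integralD weighted_integral0).
  elim/big_ind: _ => [|p q|i _]; [exact: (QC 0)|exact: QD|].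
  by rewrite weighted_integralZ; apply/QZ/QN.
suff QJ j : Q (J 'X^j).
  by move=> r; rewrite -[r]coefK poly_def; apply: Qsum => i _.
elim/ltn_ind: j => j IH; have [|lt_dj] := leqP j d; first exact: QX.
pose k := (j - d.+1)%N.
have jE : j = (d + k).+1 by rewrite /k -addSn subnKC.
pose W := J 'X^0 * 'X^k + J 'X^k.
have JW : J 'X^0 * J 'X^k = J W by rewrite weighted_integralM [_ * J _]mul1r.
have coefJ i l : (J 'X^i)`_(l + i).+1 = h`_l / (l + i).+1%:R.
  by rewrite coef_primitive_at coefXnM ltnNge leq_addl addnK.
have sizeJ i : (size (J 'X^i) <= (d + i).+2)%N.
  apply: leq_trans (size_primitive_at_leq _ _) _; rewrite ltnS.
  rewrite (leq_trans (size_polyMleq _ _)) // size_polyXn size_h.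
  by rewrite addnC addSn addnS.
have sizeW : (size W <= j.+1)%N.
  rewrite (leq_trans (size_polyD _ _)) // geq_max jE sizeJ andbT.
  rewrite (leq_trans (size_polyMleq _ _)) // size_polyXn addnS -!addSn leq_add2r.
  by rewrite -[d in d.+2]addn0 sizeJ.
(* Both summands contribute: J(1) has degree d + 1 and J(x^k) degree
   d + 1 + k, their leading coefficients being those of h divided by these
   degrees. *)
have coefW : W`_j = h`_d * (d.+1%:R^-1 + (d + k).+1%:R^-1).
  rewrite coefD coefMXn jE coefJ ltnNge (leq_trans (leq_addl d k)) //=.
  by rewrite -addSn addnK -[X in _`_X.+1]addn0 coefJ addn0 mulrDr.
have natu m : (0 < m)%N -> (m%:R : A) \is a GRing.unit by case: m.
(* The sum of the inverses of two positive integers is a unit. *)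
have Wj_unit : W`_j \is a GRing.unit.
  have -> : W`_j =
      h`_d * (((d + k).+1 + d.+1)%:R / d.+1%:R / (d + k).+1%:R).
    by rewrite coefW natrD !mulrDl mulrAC !divrr ?mul1r.
  by rewrite !(unitrM, unitrV) lead_h !natu.
have WE : W = \sum_(i < j) W`_i *: 'X^i + W`_j *: 'X^j.
  rewrite -(big_ord_recr _ (fun i => W`_i *: 'X^i)) /= -poly_def.
  apply/polyP => i; rewrite coef_poly.
  by case: ltnP => // /(leq_trans sizeW) ?; rewrite nth_default.
rewrite -[J 'X^j]scale1r -(mulVr Wj_unit) -scalerA; apply: QZ.
have -> : W`_j *: J 'X^j = J W + (-1)%:P * J (\sum_(i < j) W`_i *: 'X^i).
  rewrite [in J W]WE weighted_integralD weighted_integralZ.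
  by rewrite polyCN mulN1r addrC addKr.
apply: QD.
  by rewrite -JW; apply: QM; [apply: QX|apply: IH; rewrite jE ltnS leq_addl].
by apply: QM => //; apply: Qsum.
Qed.

End Weighted.

(** * Iterated primitives with a variable base point *)

(** In {poly {poly A}} the outer variable is x and the inner one, 'X : {poly A},
    is the base point t; map_poly (@deriv A) is differentiation in t. *)
Section IteratedPrimitive.
Variable A : idomainType.
Hypothesis uA : natr_units A.

Lemma natr_units_poly : natr_units {poly A}.
Proof. exact: natr_units_morph (@polyC A) uA. Qed.
Local Notation uP := natr_units_poly.

Implicit Types (h : {poly A}) (G : {poly {poly A}}).

Lemma deriv_map_poly_deriv G :
  (map_poly (@deriv A) G)^`() = map_poly (@deriv A) G^`().
Proof.
apply/polyP => i; rewrite coef_deriv !coef_map_id0 ?raddf0 //.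
by rewrite coef_deriv derivMn.
Qed.

(** The chain rule for G(t, t). *)
Lemma deriv_hornerX G :
  (G.['X])^`() = (map_poly (@deriv A) G).['X] + (G^`()).['X].
Proof.
elim/poly_ind: G => [|G c IH].
  by rewrite map_poly0 deriv0 !horner0 deriv0 addr0.
have -> : map_poly (@deriv A) (G * 'X + c%:P) =
    map_poly (@deriv A) G * 'X + (c^`())%:P.
  apply/polyP => i; rewrite coef_map_id0 ?raddf0 // !coefD !coefMX !coefC.
  by case: i => [|i]; rewrite /= derivD ?deriv0 // coef_map_id0 ?raddf0.
rewrite derivD derivM derivX derivC mulr1 addr0 !hornerE derivD derivM derivX.
by rewrite IH mulr1 mulrDl /= [LHS]addrAC; congr (_ + _); rewrite addrAC.
Qed.

(** Leibniz's rule for the integral of G(t, u) du from t to x. *)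
Lemma map_deriv_primitive_at G :
  map_poly (@deriv A) (primitive_at 'X G) =
  primitive_at 'X (map_poly (@deriv A) G) - (G.['X])%:P.
Proof.
apply: (deriv_eq_horner uP (t := 'X)).
  rewrite deriv_map_poly_deriv (deriv_primitive_at uP) [RHS]derivB derivC subr0.
  by rewrite (deriv_primitive_at uP).
have := deriv_hornerX (primitive_at 'X G).
rewrite (deriv_primitive_at uP) horner_primitive_at raddf0 => /esym/eqP.
rewrite addr_eq0 => /eqP ->.
by rewrite hornerD hornerN hornerC horner_primitive_at add0r.
Qed.

(** The boundary term of Leibniz's rule is h(t) at the first step and 0
    afterwards, because every primitive vanishes at x = t; it is then integrated
    k times from t. *)
Lemma map_deriv_iter_primitive h k :
  map_poly (@deriv A) (iter k.+1 (primitive_at 'X) (map_poly polyC h)) =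
  (- (h / k`!%:R)) *: ('X - 'X%:P) ^+ k.
Proof.
elim: k => [|k IH].
  rewrite map_deriv_primitive_at (_ : map_poly _ (map_poly _ _) = 0); last first.
    by apply/polyP => i; rewrite !coef_map_id0 ?raddf0 // coef0 derivC.
  rewrite (primitive_at_unique uP (q := 0)) ?deriv0 ?horner0 // sub0r.
  rewrite -[_.['X]]/(h \Po 'X) comp_polyXr fact0 divr1 expr0 -polyCN.
  by rewrite -mul_polyC mulr1.
rewrite iterS map_deriv_primitive_at IH [in X in _ - X]iterS.
rewrite horner_primitive_at subr0; apply: (primitive_at_unique uP).
  rewrite derivZ deriv_exp derivXsubC mul1r /= -scalerMnr scalerMnl.
  congr (_ *: _); rewrite mulNrn -[_ *+ k.+1]mulr_natr factS natrM.
  by rewrite invrM ?uP ?(fact_unit _ uP) // mulrA mulrVK ?uP.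
by rewrite hornerZ horner_exp hornerXsubC subrr expr0n mulr0.
Qed.

(** The previous formula gives the derivative of this coefficient in t; its value
    at t = 0 is a coefficient of order <= k in a (k + 1)-fold primitive based at
    0, hence 0. *)
Lemma coef_iter_primitive_integral h k i : (i <= k)%N ->
  exists2 c : A, c \is a GRing.unit &
  (iter k.+1 (primitive_at 'X) (map_poly polyC h))`_i =
    c *: weighted_integral h 'X^(k - i).
Proof.
move=> le_ik; set F := iter _ _ _.
exists (- (k`!%:R^-1 * ((-1) ^+ (k - i) * 'C(k, k - i)%:R))).
  rewrite unitrN !unitrM unitrV (fact_unit _ uA) unitrX ?unitrN1 //=.
  by case: 'C(k, k - i) (bin_gt0 k (k - i)) => //; rewrite leq_subr.
rewrite -(weighted_integralZ uA) /weighted_integral; apply/esym.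
apply: (primitive_at_unique uA).
  have := congr1 (fun G : {poly {poly A}} => G`_i)
    (map_deriv_iter_primitive h k).
  rewrite coef_map_id0 ?raddf0 // => ->; rewrite coefZ.
  have -> : (('X - 'X%:P) ^+ k : {poly {poly A}})`_i =
      (-1) ^+ (k - i) * 'X^(k - i) *+ 'C(k, k - i).
    have termE j : ((-1) ^+ j * 'X^(k - j) * 'X%:P ^+ j *+ 'C(k, j)
        : {poly {poly A}})`_i = (-1) ^+ j * 'X^j *+ 'C(k, j) *+ (i == k - j)%N.
      rewrite mulrAC -(rmorphN1 (@polyC _)) -!rmorphXn -rmorphM /= coefMn coefCM.
      by rewrite coefXn mulr_natr mulrnAC.
    rewrite exprBn coef_sum (bigD1 (inord (k - i))) //= termE.
    rewrite inordK ?ltnS ?leq_subr // subKn // eqxx big1 ?addr0 // => j.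
    rewrite termE; case: (i =P k - j)%N => // -> /eqP[]; apply: val_inj.
    by rewrite /= subKn ?inordK // -ltnS.
  rewrite -scalerAl -mul_polyC -[_ *+ binomial _ _]mulr_natr polyCN !polyCM.
  have -> : (k`!%:R^-1 : {poly A}) = (k`!%:R^-1)%:P.
    by rewrite -(rmorph_nat (@polyC A)) rmorphV ?fact_unit.
  rewrite rmorphXn rmorphN1 rmorph_nat /=; ring.
(* Specialize the base point to 0. *)
have -> : (F`_i).[0] = (map_poly (horner_eval 0) F)`_i by rewrite coef_map.
have -> : map_poly (horner_eval 0) F = iter k.+1 (primitive_at 0) h.
  rewrite /F; elim: (k.+1) => [|m IH].
    apply/polyP => j; rewrite !coef_map /=; exact: hornerC.
  rewrite !iterS (map_primitive_at _ uP) IH; congr (primitive_at _ _).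
  exact: hornerX.
by rewrite coef_iter_primitive0.
Qed.

End IteratedPrimitive.

(** * Polynomial rings and vanishing *)

Section PolynomialRings.

Lemma poly_morph_eq (A S : comNzRingType) (f g : {rmorphism {poly A} -> S}) :
  (forall a, f a%:P = g a%:P) -> f 'X = g 'X -> f =1 g.
Proof.
move=> fgC fgX; elim/poly_ind => [|p a IH]; first by rewrite !rmorph0.
by rewrite !rmorphD !rmorphM /= IH fgX fgC.
Qed.

Variable K : comNzRingType.

Lemma mpoly_ring_ind n (Q : {mpoly K[n]} -> Prop) :
  (forall c, Q (mpolyC n c)) -> (forall i, Q 'X_i) ->
  (forall p q, Q p -> Q q -> Q (p + q)) ->
  (forall p q, Q p -> Q q -> Q (p * q)) -> forall p, Q p.
Proof.
move=> QC QX QD QM; elim/mpolyind => [|c m p _ _ Qp]; first exact: (QC 0).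
apply: (QD) => //; rewrite -mul_mpolyC; apply: (QM) => //.
rewrite mpolyXE_id; apply: (big_ind Q) => [||i _]; [exact: (QC 1)|exact: QM|].
elim: (m i) => [|k IH]; first exact: (QC 1).
by rewrite exprS; apply: QM.
Qed.

Lemma mpoly_morph_eq n (S : comNzRingType)
    (f g : {rmorphism {mpoly K[n]} -> S}) :
  (forall c, f (mpolyC n c) = g (mpolyC n c)) ->
  (forall i, f 'X_i = g 'X_i) -> f =1 g.
Proof.
move=> fgC fgX; elim/mpoly_ring_ind => // p q fgp fgq.
  by rewrite !rmorphD fgp fgq.
by rewrite !rmorphM fgp fgq.
Qed.

Lemma muniXU n (i : 'I_n) :
  muni ('X_(widen_ord (leqnSn n) i) : {mpoly K[n.+1]}) = ('X_i)%:P.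
Proof.
rewrite muniE msuppX big_seq1 mcoeffX eqxx scale1r mnm1E /=.
rewrite -[_ == ord_max]val_eqE /= ltn_eqF // -mul_polyC mulr1; congr 'X_[_]%:P.
by apply/mnmP => j; rewrite mnmE !mnm1E -!val_eqE.
Qed.

Lemma muniXmax n : muni ('X_ord_max : {mpoly K[n.+1]}) = 'X.
Proof.
rewrite muniE msuppX big_seq1 mcoeffX eqxx scale1r mnm1E eqxx.
rewrite (_ : [multinom _ | _ < _] = 0%MM) ?mpolyX0 ?scale1r //.
by apply/mnmP => j; rewrite mnmE mnm1E mnm0E -val_eqE /= gtn_eqF.
Qed.

Lemma mwidenXU n (i : 'I_n) :
  mwiden ('X_i : {mpoly K[n]}) = 'X_(widen_ord (leqnSn n) i).
Proof. by rewrite mwidenX mnmwiden1. Qed.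

Lemma ord_max_or_widen n (i : 'I_n.+1) :
  i = ord_max \/ exists j, i = widen_ord (leqnSn n) j.
Proof.
case: (unliftP ord_max i) => [j ->|->]; [right; exists j|by left].
by apply: val_inj; rewrite /= /bump leqNgt ltn_ord.
Qed.

(** The inverse of muni substitutes the last variable for 'X. *)
Lemma muniK n (p : {mpoly K[n.+1]}) :
  (map_poly (@mwiden n K) (muni p)).['X_ord_max] = p.
Proof.
pose f := horner_eval ('X_ord_max : {mpoly K[n.+1]}) \o
  (map_poly (@mwiden n K) \o @muni n K).
apply: (mpoly_morph_eq (f := f) (g := idfun)) => [c|i].
  by rewrite /f /= muniC map_polyC /= mwidenC [LHS]hornerC.
rewrite /f /=; case: (ord_max_or_widen i) => [->|[j ->]].
  by rewrite muniXmax map_polyX [LHS]hornerX.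
by rewrite muniXU map_polyC /= mwidenXU [LHS]hornerC.
Qed.

End PolynomialRings.

Section ZeroPolynomial.
Variable K : idomainType.
Hypothesis uK : natr_units K.

(** The integers 0, ..., size p - 1 are too many distinct roots. *)
Lemma poly_vanishing (p : {poly K}) : (forall t, p.[t] = 0) -> p = 0.
Proof.
move=> p0; apply/eqP/negPn/negP => nz.
have := max_poly_roots nz (rs := [seq i%:R | i <- iota 0 (size p)]).
rewrite size_map size_iota ltnn => h; apply/notF/h.
  by apply/allP => x _; rewrite /root p0.
rewrite map_inj_uniq ?iota_uniq //.
suff lt_neq i j : (i < j)%N -> i%:R != j%:R :> K.
  by move=> i j eq_ij; case: (ltngtP i j) => // /lt_neq; rewrite eq_ij eqxx.
move=> lt_ij; rewrite eq_sym -subr_eq0 -natrB 1?ltnW //.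
case: (j - i)%N (subn_gt0 i j) => [|k _]; first by rewrite lt_ij.
by apply: contraTneq (uK k) => ->; rewrite unitr0.
Qed.

Lemma mpoly_vanishing n (p : {mpoly K[n]}) : (forall x, p.@[x] = 0) -> p = 0.
Proof.
elim: n p => [|n IH] p p0.
  by move: (p0 (fun => 0)); rewrite [p]nvar0_mpolyC mevalC => ->.
rewrite -[p]muniK (_ : muni p = 0) ?raddf0 ?horner0 //.
apply/polyP => i; rewrite coef0; apply: IH => s.
pose x t (j : 'I_n.+1) := if unlift ord_max j is Some j' then s j' else t.
pose f t := horner_eval t \o (map_poly (meval s) \o @muni n K).
have fE t : f t =1 meval (x t).
  apply: (mpoly_morph_eq (f := f t) (g := meval (x t))) => [c|j].
    by rewrite /f /= muniC map_polyC /= !mevalC [LHS]hornerC.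
  rewrite /f /= mevalXU /x; case: unliftP => [j'|] ->.
    rewrite (_ : lift _ _ = widen_ord (leqnSn n) j').
      by rewrite muniXU map_polyC /= mevalXU [LHS]hornerC.
    by apply: val_inj; rewrite /= /bump leqNgt ltn_ord.
  by rewrite muniXmax map_polyX [LHS]hornerX.
rewrite -coef_map (_ : map_poly _ _ = 0) ?coef0 //.
by apply: poly_vanishing => t; rewrite -[LHS]/(f t p) fE.
Qed.

End ZeroPolynomial.

(** * Coordinates of iterated primitives *)

Section DividedCoords.
Variable R : comUnitRingType.
Hypothesis uR : natr_units R.

Lemma coef_divided_poly_fact d (s : 'I_d -> R) (i : 'I_d) :
  (divided_poly s)`_(d - i.+1) * (d - i.+1)`!%:R = s i.
Proof. by rewrite coef_divided_poly mulrVK ?fact_unit. Qed.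

Lemma divided_poly_iter_primitive t d (s : 'I_d -> R) k m :
  m = (k + d)%N ->
  let F := iter k (primitive_at t) (divided_poly s) in
  divided_poly (divided_coords m F) = F.
Proof.
move=> -> /=; apply: divided_coordsK => [l||].
- exact: fact_unit.
- rewrite -addnS (leq_trans (size_iter_primitive _ _ _)) // leq_add2l.
  exact: size_divided_poly.
- have := coef_iter_primitive uR t (divided_poly s) k d.
  rewrite coef_divided_polym mulVr ?fact_unit // => e.
  by rewrite -[LHS](mulrK (fact_unit (k + d) uR)) e mul1r.
Qed.

(** With divided powers, integration keeps the coefficients s_1, ..., s_d and
    appends new ones after them. *)
Lemma divided_coords_iter_primitive t d (s : 'I_d -> R) k m
    (i : 'I_m) (j : 'I_d) :
  m = (k + d)%N -> i = j :> nat ->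
  divided_coords m (iter k (primitive_at t) (divided_poly s)) i = s j.
Proof.
move=> mE ij; rewrite /divided_coords ij {}mE -addnBA //.
by rewrite coef_iter_primitive // coef_divided_poly_fact.
Qed.

Lemma deriv_divided_poly m (s : 'I_m.+1 -> R) :
  (divided_poly s)^`() =
  divided_poly (fun i : 'I_m => s (widen_ord (leqnSn m) i)).
Proof.
rewrite /divided_poly derivD derivZ derivXn raddf_sum /= big_ord_recr /=.
rewrite subnn derivZ expr0 derivC scaler0 addr0; congr (_ + _).
  rewrite -scaler_nat scalerA factS natrM invrM ?uR ?fact_unit //.
  by rewrite mulrVK ?uR.
apply: eq_bigr => i _; rewrite derivZ derivXn subSn //= -scaler_nat scalerA.
by rewrite factS natrM invrM ?uR ?fact_unit // mulrA mulrVK ?uR.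
Qed.

End DividedCoords.

Lemma divided_coords_integral (A : idomainType) (uA : natr_units A) d
    (s : 'I_d -> A) k m (i : 'I_m) :
  m = (k.+1 + d)%N -> (d <= i)%N ->
  exists2 c : A, c \is a GRing.unit &
  divided_coords m
      (iter k.+1 (primitive_at 'X) (map_poly polyC (divided_poly s))) i =
    c *: weighted_integral (divided_poly s) 'X^(k - (m - i.+1)).
Proof.
move=> mE le_di; have le_k : (m - i.+1 <= k)%N.
  by rewrite leq_subLR [leqLHS]mE addSn ltnS addnC leq_add2r.
have [c uc e] := coef_iter_primitive_integral uA (divided_poly s) le_k.
exists (c * (m - i.+1)`!%:R); first by rewrite unitrM uc fact_unit.
by rewrite /divided_coords e mulrC -polyC_natr mul_polyC scalerA mulrC.
Qed.

Lemma divided_coords_iter_primitive_polyC (A : idomainType)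
    (uA : natr_units A) d (s : 'I_d -> A) k m (i : 'I_m) (j : 'I_d) :
  m = (k + d)%N -> i = j :> nat ->
  divided_coords m
      (iter k (primitive_at 'X) (map_poly polyC (divided_poly s))) i = (s j)%:P.
Proof.
move=> mE ij; rewrite (map_divided_poly _ uA).
by rewrite (divided_coords_iter_primitive (natr_units_poly uA) 'X _ mE ij).
Qed.

(** * The parametrization of the normalized discriminant *)

Section Parametrization.
Variables (R : comUnitRingType) (d : nat).

(** The point (f, t) such that f has second derivative divided_poly s and a
    double root at t. The ring is arbitrary because the map is needed both at
    K-points and at the generic point. *)
Definition param (s : 'I_d -> R) (t : R) (i : 'I_d.+3) : R :=
  if unlift ord_max i is Some j
  then divided_coords d.+2 (iter 2 (primitive_at t) (divided_poly s)) j else t.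

Lemma param_widen s t (j : 'I_d.+2) :
  param s t (widen_ord (leqnSn d.+2) j) =
  divided_coords d.+2 (iter 2 (primitive_at t) (divided_poly s)) j.
Proof.
rewrite /param (_ : widen_ord _ j = lift ord_max j) ?liftK //.
by apply: val_inj; rewrite /= /bump leqNgt ltn_ord.
Qed.

Lemma param_ext s1 s2 t1 t2 :
  s1 =1 s2 -> t1 = t2 -> param s1 t1 =1 param s2 t2.
Proof.
by move=> es -> i; rewrite /param (divided_poly_eq es).
Qed.

Lemma param_max s t : param s t ord_max = t.
Proof. by rewrite /param unlift_none. Qed.

Definition widen3 (i : 'I_d) : 'I_d.+3 :=
  widen_ord (leqnSn d.+2) (widen_ord (leqnSn d.+1) (widen_ord (leqnSn d) i)).

Hypothesis uR : natr_units R.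

Lemma divided_poly_param s t :
  divided_poly (fun j => param s t (widen_ord (leqnSn d.+2) j)) =
  iter 2 (primitive_at t) (divided_poly s).
Proof.
rewrite (divided_poly_eq (param_widen s t)).
exact: (divided_poly_iter_primitive uR).
Qed.

Lemma param_widen3 s t i : param s t (widen3 i) = s i.
Proof. by rewrite param_widen; apply: divided_coords_iter_primitive. Qed.

End Parametrization.

Lemma param_morph (R S : comUnitRingType) (f : {rmorphism R -> S}) d
    (s : 'I_d -> R) t i :
  natr_units R -> f (param s t i) = param (f \o s) (f t) i.
Proof.
move=> uR; rewrite /param; case: unlift => // j.
rewrite -[LHS]/((f \o _) j) map_divided_coords.
by rewrite !(map_primitive_at _ uR) (map_divided_poly _ uR).
Qed.

(** A double root of f at t makes f the primitive of f' and f' the primitive of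
    f'' that vanish at t. *)
Lemma NormDiscriminantP (K : fieldType) d (y : 'I_d.+3 -> K) : natr_units K ->
  NormDiscriminant K d.+2 y <-> y =1 param (y \o @widen3 d) (y ord_max).
Proof.
move=> uK; set s := y \o _; set t := y _; split=> [[f0 f1] i|yE].
  have f2 : (pt_poly y)^`()^`() = divided_poly s.
    by rewrite /pt_poly !(deriv_divided_poly uK); apply: divided_poly_eq.
  case: (ord_max_or_widen i) => [->|[j ->]]; first by rewrite param_max.
  rewrite param_widen /= -f2 (primitive_at_unique uK erefl); last exact/eqP.
  rewrite (primitive_at_unique uK erefl); last exact/eqP.
  by rewrite /divided_coords coef_divided_poly mulrVK ?fact_unit.
have fE : pt_poly y = iter 2 (primitive_at t) (divided_poly s).
  by rewrite -(divided_poly_param uK); apply: divided_poly_eq => j; rewrite yE.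
rewrite /NormDiscriminant fE /= /pt_root; split; rewrite /root.
  by rewrite horner_primitive_at.
by rewrite (deriv_primitive_at uK) horner_primitive_at.
Qed.

(** * Derivations and differentials *)

(** A derivation that kills the coefficients is determined by its value on the
    variable. *)
Lemma derivation_chain (R : comNzRingType) d (C B : comPzRingType)
    (phi : {rmorphism C -> B}) (chi : {rmorphism {poly {mpoly R[d]}} -> B})
    (M : lmodType B) (D : B -> M) : derivation phi D ->
  (forall c, exists a, chi (mpolyC d c)%:P = phi a) ->
  (forall i, exists a, chi ('X_i)%:P = phi a) ->
  forall q, D (chi q) = chi q^`() *: D (chi 'X).
Proof.
move=> [dD dM d0] chiC chiX.
pose f : {rmorphism {mpoly R[d]} -> B} := chi \o polyC.
have dC a : D (f a) = 0.
  elim/mpoly_ring_ind: a => [c|i|a b Ha Hb|a b Ha Hb].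
  - by have [a e] := chiC c; rewrite /f /= e.
  - by have [a e] := chiX i; rewrite /f /= e.
  - by rewrite rmorphD dD Ha Hb addr0.
  - by rewrite rmorphM dM Ha Hb !scaler0 addr0.
elim/poly_ind => [|q a IH].
  by rewrite deriv0 rmorph0 scale0r -(rmorph0 phi) d0.
rewrite rmorphD rmorphM dD -[chi a%:P]/(f a) dC addr0 dM IH.
rewrite derivD derivM derivX derivC addr0 mulr1.
by rewrite rmorphD rmorphM /= scalerDl scalerA addrC mulrC.
Qed.

Lemma scaleM_eq0 (A B : comPzRingType) (f : {rmorphism A -> B}) (M : lmodType B)
    (w : M) p q :
  f q *: w = 0 -> f (p * q) *: w = 0.
Proof. by move=> e; rewrite rmorphM -scalerA e scaler0. Qed.

Lemma scale_unit_eq0 (A : comUnitRingType) (B : comPzRingType)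
    (f : {rmorphism {poly A} -> B}) (M : lmodType B) (w : M) c p :
  c \is a GRing.unit -> f (c *: p) *: w = 0 -> f p *: w = 0.
Proof.
move=> uc e; rewrite -[p]scale1r -(mulVr uc) -scalerA -mul_polyC.
exact: scaleM_eq0.
Qed.

(** A vanishing differential is detected by any derivation D of B (transported
    here to an isomorphic ring Q) that sends the base ring into an ideal, namely
    the one generated by h: D then induces a linear map from the differentials to
    the quotient by that ideal. This map is lifted to the free module, where the
    relations are checked to land in the ideal. *)
Lemma kaehler_d_eq0 (A B Q : comPzRingType) (phi : {rmorphism A -> B})
    (chi : {rmorphism Q -> B}) (g : B -> Q) (D : Q -> Q) (h : Q) :
  cancel chi g -> cancel g chi ->
  (forall x y, D (x + y) = D x + D y) ->
  (forall x y, D (x * y) = D x * y + x * D y) ->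
  (forall a, exists r, D (g (phi a)) = r * h) ->
  forall q, kaehler_d phi (chi q) = 0 -> exists r, D q = r * h.
Proof.
move=> chiK gK DD DM ID q.
pose l : {linear free_module B B -> B^o} :=
  free_lift (fun b => chi (D (g b)) : B^o).
have lg x : l (free_gen B (chi x)) = chi (D x).
  by rewrite [LHS]free_lift_gen chiK.
have lB u v : l (u - v) = l u - l v := raddfB l u v.
have lD u v : l (u + v) = l u + l v := raddfD l u v.
have lZ b u : l (b *: u) = b * l u := linearZZ l b u.
have l_span v : kaehler_span phi v -> exists r, l v = chi (r * h).
  elim=> [|c r w hr _ [t IH]]; first by exists 0; rewrite mul0r rmorph0 raddf0.
  suff [u lr] : exists u, l r = chi (u * h).
    exists (g c * u + t); rewrite lD lZ IH lr -{1}[c]gK.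
    by rewrite mulrDl rmorphD -mulrA [in RHS]rmorphM.
  case: hr => [x y|x y|a].
  - exists 0; rewrite mul0r rmorph0 -[x]gK -[y]gK -rmorphD.
    by rewrite lB lD !lg DD rmorphD subrr.
  - exists 0; rewrite mul0r rmorph0 -[x]gK -[y]gK -rmorphM.
    rewrite lB lD !lZ !lg DM rmorphD !rmorphM.
    by rewrite [X in X - _]addrC [chi (D _) * _]mulrC subrr.
  - by have [u e] := ID a; exists u; rewrite -e -lg gK.
have <- : \pi_(kaehler phi) 0%R = 0 :> kaehler phi by rewrite !piE.
move/kaehler_eq/l_span => [r]; rewrite subr0 lg => /(can_inj chiK) e.
by exists r.
Qed.

(** * The coordinate ring of the normalized discriminant *)

Section Comorphism.
Local Notation coord := Defs.coord.
Variables (K : fieldType) (d : nat).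
Hypothesis uK : natr_units K.

Local Notation A := {mpoly K[d]}.
Local Notation P := {mpoly K[d.+3]}.
Local Notation B := (coord_ring (NormDiscriminant K d.+2)).

Let uA : natr_units A.
Proof. exact: natr_units_morph (@mpolyC d K) uK. Qed.
Let uAX : natr_units {poly A}.
Proof. exact: natr_units_poly. Qed.

(** f'' for the generic f; its coefficients are the free coordinates s_i. *)
Definition generic_deriv2 : {poly A} := divided_poly (fun i : 'I_d => 'X_i).
Local Notation h := generic_deriv2.

(** Restriction of functions on the ambient affine space along the
    parametrization. *)
Definition comorphism : P -> {poly A} :=
  mmap (polyC \o @mpolyC d K) (param (fun i => ('X_i)%:P) 'X).
HB.instance Definition _ := GRing.RMorphism.copy comorphism
  (mmap (polyC \o @mpolyC d K) (param (fun i => ('X_i)%:P) 'X)).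

Lemma comorphismC c : comorphism (mpolyC _ c) = (mpolyC d c)%:P.
Proof. by rewrite /comorphism mmapC. Qed.

Lemma comorphismX i : comorphism 'X_i = param (fun i => ('X_i)%:P) 'X i.
Proof. by rewrite /comorphism mmapX mmap1U. Qed.

(** The section of the comorphism that uses only the coordinates s_1, ..., s_d
    and t of the ambient space. *)
Definition param_lift : {poly A} -> P :=
  horner_eval 'X_ord_max \o
    map_poly (@mwiden d.+2 K \o (@mwiden d.+1 K \o @mwiden d K)).
HB.instance Definition _ := GRing.RMorphism.on param_lift.

Lemma param_liftX : param_lift 'X = 'X_ord_max.
Proof. by rewrite /param_lift /= map_polyX [LHS]hornerX. Qed.

Lemma param_liftC a : param_lift a%:P = mwiden (mwiden (mwiden a)).
Proof. by rewrite /param_lift /= map_polyC [LHS]hornerC. Qed.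

Lemma param_liftK : cancel param_lift comorphism.
Proof.
apply: (poly_morph_eq (f := comorphism \o param_lift) (g := idfun)) => [a|];
  last first.
  by rewrite /= param_liftX comorphismX param_max.
apply: (mpoly_morph_eq (f := comorphism \o (param_lift \o polyC))
  (g := polyC)) => [c|i].
  by rewrite /= param_liftC !mwidenC comorphismC.
by rewrite /= param_liftC !mwidenXU comorphismX param_widen3.
Qed.

Definition eval_at (s : 'I_d -> K) (t : K) : {poly A} -> K :=
  horner_eval t \o map_poly (meval s).
HB.instance Definition _ s t := GRing.RMorphism.on (eval_at s t).

Lemma eval_at_comorphism s t p : eval_at s t (comorphism p) = p.@[param s t].
Proof.
apply: (mpoly_morph_eq (f := eval_at s t \o comorphism)
  (g := meval _)) => [c|i].
  by rewrite /= comorphismC /eval_at /= map_polyC /= !mevalC [LHS]hornerC.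
rewrite /= comorphismX mevalXU (param_morph (eval_at s t)) //.
apply: param_ext => [j|] /=.
  by rewrite /eval_at /= map_polyC /= mevalXU [LHS]hornerC.
by rewrite /eval_at /= map_polyX [LHS]hornerX.
Qed.

(** The parametrization reaches every point, and a polynomial over an infinite
    field that vanishes at every point is 0. *)
Lemma vanishing_comorphism p :
  (p \in vanishing (NormDiscriminant K d.+2)) = (comorphism p == 0).
Proof.
apply/vanishingP/eqP => [p0|p0 y /(NormDiscriminantP _ uK) yE]; last first.
  by rewrite (meval_eq _ yE) -eval_at_comorphism p0 rmorph0.
apply/polyP => i; rewrite coef0; apply: (mpoly_vanishing uK) => s.
rewrite -coef_map (_ : map_poly _ _ = 0) ?coef0 //.
apply: (poly_vanishing uK) => t.
rewrite -[LHS]/(eval_at s t (comorphism p)) eval_at_comorphism; apply: p0.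
apply/(NormDiscriminantP _ uK) => j.
rewrite param_max; apply: param_ext => // l /=.
by rewrite param_widen3.
Qed.

Local Notation N := (NormDiscriminant K d.+2).

Lemma coord_eq_comorphism p q :
  coord N p = coord N q <-> comorphism p = comorphism q.
Proof.
apply: iff_trans (coord_eq _ _ _) _.
rewrite vanishing_comorphism rmorphB subr_eq0.
by split=> /eqP.
Qed.

Lemma comorphism_repr p : comorphism (repr (coord N p)) = comorphism p.
Proof. by apply/coord_eq_comorphism; rewrite coordK. Qed.

(** The isomorphism from A[t] onto the coordinate ring. *)
Definition coord_of_poly : {poly A} -> B := coord _ \o param_lift.
HB.instance Definition _ := GRing.RMorphism.on coord_of_poly.

Lemma coord_of_comorphism p : coord_of_poly (comorphism p) = coord _ p.
Proof. by apply/coord_eq_comorphism; rewrite param_liftK. Qed.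

Local Notation phi := (pullback (forget_root K d.+2)).
Local Notation d_ := (kaehler_d phi).

Lemma size_generic_deriv2 : size h = d.+1.
Proof.
apply/eqP; rewrite eqn_leq size_divided_poly ltnNge /=; apply/negP => le.
have := fact_unit d uA.
rewrite -unitrV -(coef_divided_polym (fun i : 'I_d => 'X_i : A)).
by rewrite nth_default // unitr0.
Qed.

Lemma phi_coord p : phi (coord _ p) = coord N (p \mPo forget_root_tuple K d.+2).
Proof. exact: pullbackE. Qed.

Lemma phi_coordX i :
  phi (coord _ 'X_i) = coord N 'X_(widen_ord (leqnSn d.+2) i).
Proof. by rewrite phi_coord comp_mpolyXU -tnth_nth tnth_mktuple. Qed.

(** * The subring of polynomials whose derivative is divisible by h *)

Definition deriv_dvd (q : {poly A}) := exists r, q^`() = r * h.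

Lemma deriv_dvdC a : deriv_dvd a%:P.
Proof. by exists 0; rewrite derivC mul0r. Qed.

Lemma deriv_dvdD p q : deriv_dvd p -> deriv_dvd q -> deriv_dvd (p + q).
Proof.
by move=> [r1 e1] [r2 e2]; exists (r1 + r2); rewrite derivD e1 e2 mulrDl.
Qed.

Lemma deriv_dvdM p q : deriv_dvd p -> deriv_dvd q -> deriv_dvd (p * q).
Proof.
move=> [r1 e1] [r2 e2]; exists (r1 * q + p * r2); rewrite derivM e1 e2.
by rewrite mulrDl mulrAC mulrA.
Qed.

Lemma deriv_dvd_integral c p : deriv_dvd (c *: weighted_integral h p).
Proof.
exists (c *: p).
by rewrite derivZ (deriv_primitive_at uA) scalerAl.
Qed.

(** The coordinates of an iterated primitive of h are s_1, ..., s_d followed by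
    integrals against h. *)
Lemma deriv_dvd_divided_coords k m (i : 'I_m) : m = (k.+1 + d)%N ->
  deriv_dvd
    (divided_coords m (iter k.+1 (primitive_at 'X) (map_poly polyC h)) i).
Proof.
move=> mE; have [lt_id|le_di] := ltnP i d.
  rewrite (divided_coords_iter_primitive_polyC uA _ mE
    (j := Ordinal lt_id)) //.
  exact: deriv_dvdC.
have [c _ ->] :=
  divided_coords_integral uA (fun j : 'I_d => 'X_j : A) mE le_di.
exact: deriv_dvd_integral.
Qed.

Lemma comorphismX_widen (i : 'I_d.+2) :
  comorphism 'X_(widen_ord (leqnSn d.+2) i) =
  divided_coords d.+2 (iter 2 (primitive_at 'X) (map_poly polyC h)) i.
Proof.
by rewrite comorphismX param_widen -(map_divided_poly (@polyC A) uA).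
Qed.

Lemma deriv_dvd_comorphismX (i : 'I_d.+2) :
  deriv_dvd (comorphism 'X_(widen_ord (leqnSn d.+2) i)).
Proof.
rewrite comorphismX_widen; exact: deriv_dvd_divided_coords.
Qed.

(** The functions on the discriminant itself; they are generated by the
    coordinates of f. *)
Lemma deriv_dvd_base a p : phi a = coord N p -> deriv_dvd (comorphism p).
Proof.
rewrite -[a]coordK phi_coord => /coord_eq_comorphism <-.
elim/mpoly_ring_ind: (repr a) => [c|i|q r|q r].
- by rewrite comp_mpolyC comorphismC; apply: deriv_dvdC.
- by rewrite comp_mpolyXU -tnth_nth tnth_mktuple; apply: deriv_dvd_comorphismX.
- by rewrite comp_mpolyD rmorphD; apply: deriv_dvdD.
- by rewrite rmorphM /= rmorphM; apply: deriv_dvdM.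
Qed.

Lemma kaehler_d_coord_of_poly q :
  d_ (coord_of_poly q) = coord_of_poly q^`() *: d_ (coord_of_poly 'X).
Proof.
apply: (derivation_chain (chi := coord_of_poly)
  (kaehler_d_derivation phi)) => [c|i].
  exists (coord _ (mpolyC _ c)); rewrite [RHS]phi_coord comp_mpolyC.
  by rewrite -[LHS]/(coord _ (param_lift _)) param_liftC !mwidenC.
exists (coord _ 'X_(widen_ord (leqnSn _) (widen_ord (leqnSn _) i))).
rewrite [RHS]phi_coordX -[LHS]/(coord _ (param_lift _)) param_liftC.
by rewrite !mwidenXU.
Qed.

(** The coordinate s_(n-1) of f is a unit times the integral of h from 0 to
    t. *)
Lemma deriv_comorphismX_unit : exists i, exists2 c : A, c \is a GRing.unit &
  (comorphism 'X_(widen_ord (leqnSn d.+2) i))^`() = c *: h.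
Proof.
have lt_d : (d < d.+2)%N by [].
exists (Ordinal lt_d).
have [c uc e] := divided_coords_integral uA (fun j : 'I_d => 'X_j : A)
  (i := Ordinal lt_d) (erefl (2 + d)%N) (leqnn d).
exists c => //; rewrite comorphismX_widen e derivZ.
by rewrite (deriv_primitive_at uA) subSnn mul1r.
Qed.

(** The differential of s_(n-1), a function on the discriminant, vanishes. *)
Lemma generic_deriv2_d : coord_of_poly h *: d_ (coord_of_poly 'X) = 0.
Proof.
have [_ _ d0] := kaehler_d_derivation phi.
have [i [c uc dr]] := deriv_comorphismX_unit.
have := kaehler_d_coord_of_poly (comorphism 'X_(widen_ord (leqnSn d.+2) i)).
rewrite dr coord_of_comorphism -phi_coordX d0 => /esym; exact: scale_unit_eq0.
Qed.

(** The differential of q is (dq/dt) dt and h(t) dt = 0. Conversely, d/dt maps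
    the functions on the discriminant into the ideal of h, which makes it a
    derivation relative to the discriminant modulo that ideal. *)
Lemma kaehler_d_coord p : d_ (coord N p) = 0 <-> deriv_dvd (comorphism p).
Proof.
rewrite -coord_of_comorphism; split=> [|[r dr]]; last first.
  rewrite kaehler_d_coord_of_poly dr; exact: scaleM_eq0 generic_deriv2_d.
apply: (kaehler_d_eq0 (phi := phi) (chi := coord_of_poly) (D := @deriv A)
  (g := fun b => comorphism (repr b))) => [q|b|||a].
- exact: etrans (comorphism_repr (param_lift q)) (param_liftK q).
- exact: etrans (coord_of_comorphism (repr b)) (coordK b).
- exact: derivD.
- exact: derivM.
- exact: deriv_dvd_base (esym (coordK (phi a))).
Qed.

(** * The image of the coordinate ring of the geometric swallowtail *)

Section Image.
Hypothesis d_gt0 : (0 < d)%N.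

Local Notation m := (2 * d.+2 - 3)%N.
Local Notation lift := (normalization_tuple K d.+2).

Let mE : m = (d.+1 + d)%N.
Proof.
rewrite mul2n -addnn; case: (d) d_gt0 => // k _.
by rewrite !addSn !subSS subn0 !addnS.
Qed.

(** Of the d + 1 primitives of h, two rebuild f and the other n - 3 lift f. *)
Lemma comorphism_lift (i : 'I_m) :
  comorphism (tnth lift i) =
  divided_coords m (iter d.+1 (primitive_at 'X) (map_poly polyC h)) i.
Proof.
have uP : natr_units P by exact: natr_units_morph (@mpolyC d.+3 K) uK.
rewrite tnth_mktuple -[LHS]/((comorphism \o _) i) map_divided_coords.
congr (divided_coords m _ i); rewrite /universal_lift.
have -> : iter d.+1 (primitive_at 'X) (map_poly polyC h) =
    iter (d.+2 - 3) (primitive_at 'X)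
      (iter 2 (primitive_at 'X) (map_poly polyC h)).
  have kE : (d.+2 - 3 + 2 = d.+1)%N by rewrite !subSS subn1 addn2 prednK.
  by rewrite -iterD kE.
elim: (_ - 3)%N => [|k IH].
  rewrite (map_divided_poly _ uP) -[LHS]/(divided_poly _) [RHS]/=.
  rewrite (map_divided_poly (@polyC A) uA) -[RHS](divided_poly_param uAX).
  by apply: divided_poly_eq => j; rewrite /= comorphismX.
rewrite !iterS (map_primitive_at _ uP) IH.
by rewrite -[X in primitive_at X _]/(comorphism _) comorphismX param_max.
Qed.

Lemma deriv_dvd_lift_image a : deriv_dvd (comorphism (a \mPo lift)).
Proof.
elim/mpoly_ring_ind: a => [c|i|a b|a b].
- by rewrite comp_mpolyC comorphismC; apply: deriv_dvdC.
- rewrite comp_mpolyXU -tnth_nth comorphism_lift.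
  exact: deriv_dvd_divided_coords.
- by rewrite comp_mpolyD rmorphD; apply: deriv_dvdD.
- by rewrite rmorphM /= rmorphM; apply: deriv_dvdM.
Qed.

Lemma lift_image_deriv_dvd q :
  deriv_dvd q -> exists a, comorphism (a \mPo lift) = q.
Proof.
pose Q q := exists a, comorphism (a \mPo lift) = q.
have QD p1 p2 : Q p1 -> Q p2 -> Q (p1 + p2).
  by move=> [a <-] [b <-]; exists (a + b); rewrite comp_mpolyD rmorphD.
have QM p1 p2 : Q p1 -> Q p2 -> Q (p1 * p2).
  by move=> [a <-] [b <-]; exists (a * b); rewrite rmorphM /= rmorphM.
have QX (i : 'I_m) :
    Q (divided_coords m (iter d.+1 (primitive_at 'X) (map_poly polyC h)) i).
  by exists 'X_i; rewrite comp_mpolyXU -tnth_nth comorphism_lift.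
have QC a : Q a%:P.
  elim/mpoly_ring_ind: a => [c|j|a b|a b].
  - by exists (mpolyC _ c); rewrite comp_mpolyC comorphismC.
  - have lt_jm : (j < m)%N by rewrite mE ltn_addl.
    have := QX (Ordinal lt_jm).
    by rewrite (divided_coords_iter_primitive_polyC uA _ mE (j := j)).
  - by rewrite polyCD; apply: QD.
  - by rewrite polyCM; apply: QM.
have QJ j : (j <= d)%N -> Q (weighted_integral h 'X^j).
  move=> le_jd; have lt_im : (d + j < m)%N by rewrite mE addSn ltnS leq_add2l.
  (* Counted from 0, coordinate number d + j is the coefficient of x^(d - j). *)
  have := QX (Ordinal lt_im).
  have [c uc ->] := divided_coords_integral uA (fun j : 'I_d => 'X_j : A)
    (i := Ordinal lt_im) mE (leq_addr j d).
  have -> : (d - (m - (Ordinal lt_im).+1) = j)%N.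
    by rewrite /= [X in (_ - (X - _))%N]mE addSn subSS subnDl subKn.
  move=> Qcj; rewrite -[weighted_integral _ _]scale1r -(mulVr uc) -scalerA.
  by rewrite -mul_polyC; apply: QM.
case=> r /(weighted_integral_deriv uA) ->; apply: (QD); first exact: QC.
apply: (weighted_integral_gen uA size_generic_deriv2 _ QC QD QM QJ).
by rewrite coef_divided_polym unitrV fact_unit.
Qed.

End Image.
End Comorphism.

Theorem theorem4p3 (K : closedFieldType) (char0 : [pchar K]%R =i pred0)
    (n : nat) (n_ge3 : (3 <= n)%N)
    (b : coord_ring (NormDiscriminant K n)) :
  (exists a : coord_ring (geometric_open_swallowtail K n),
     pullback (normalization char0 n_ge3) a = b) <->
  algebraic_open_swallowtail b.
Proof.
have uK : natr_units K.
  by move=> k; rewrite unitfE (iffLR (pcharf0P K) char0).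
case: n n_ge3 b => [|[|d]] // n_ge3 b; rewrite -[b]coordK.
apply: iff_trans (iff_sym (kaehler_d_coord uK (repr b))).
split=> [[a]|/(lift_image_deriv_dvd uK n_ge3) [a e]].
  rewrite -[a]coordK pullbackE => /(coord_eq_comorphism uK) <-.
  exact: deriv_dvd_lift_image.
by exists (Defs.coord _ a); rewrite pullbackE; apply/(coord_eq_comorphism uK).
Qed.
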